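(* For every positive integer $m$, \[ \beta(2m)=\sum_{k=1}^{m} (-1)^{k-1}\,\beta(2m-2k+1)\,J(2k-1). \]
   Context: The Dirichlet beta function is $\beta(s)=\sum_{n=1}^\infty (-1)^{n-1}(2n-1)^{-s}$ for $\Re(s)>0$. For $\Re(s)>0$, define \[ J(s)=\frac{1}{\Gamma(s+1)}\cdot\frac{2}{\pi}\int_0^{\pi/2}\frac{x^s}{\sin x}\,dx . \] *)

(* Defs.v *)
From Stdlib Require Import Reals.
From Coquelicot Require Import Coquelicot.

Local Open Scope C_scope.

Definition Cexp (z : C) : C :=
  ((exp (Re z) * cos (Im z))%R, (exp (Re z) * sin (Im z))%R).

(* [x ^ s = exp (s * ln x)]; meaningful for [0 < x] only, as Stdlib sets
   [ln x = 0] for [x <= 0]. *)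
Definition cpower (x : R) (s : C) : C := Cexp (s * RtoC (ln x)).

Definition CSeries (a : nat -> C) : C :=
  iota (T := C_CompleteNormedModule) (is_series (V := C_NormedModule) a).

(* Integral over [R] of a complex-valued function, improper at the filters
   [Fa] and [Fb]. *)
Definition CRInt_gen (f : R -> C) (Fa Fb : (R -> Prop) -> Prop) : C :=
  RInt_gen (V := C_R_CompleteNormedModule) f Fa Fb.

(* Euler's integral, for [0 < Re s]. *)
Definition Gamma (s : C) : C :=
  CRInt_gen (fun t : R => cpower t (s - 1) * RtoC (exp (- t)))
    (at_right 0%R) (Rbar_locally p_infty).

(* For [0 < Re s].  Series indices start at 0, so the [n]-th term here is
   [(-1)^(N-1) (2N-1)^(-s)] with [N = n + 1]. *)
Definition beta (s : C) : C :=
  CSeries (fun n : nat => RtoC ((-1) ^ n) * cpower (INR (2 * n + 1)) (- s)).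

(* For [0 < Re s].  The integral is improper at 0 when [Re s < 1]. *)
Definition J (s : C) : C :=
  1 / Gamma (s + 1) * RtoC (2 / PI) *
  CRInt_gen (fun x : R => cpower x s / RtoC (sin x))
    (at_right 0%R) (at_point (PI / 2)%R).

(* Main.v *)
(** For [S_N x = sum_{n <= N} (-1)^n sin ((2n+1) x) / (2n+1)^(2m)] the Taylor
    polynomial of degree [2m - 1] at [0] is
    [P_N x = sum_{k=1}^m (-1)^(k-1) beta_N (2m-2k+1) x^(2k-1) / (2k-1)!], where
    [beta_N] is a partial sum of the beta series.  On [[0, pi/2)] one has
    [|S_N x - P_N x| <= C_m x / N]: for [m = 1] because the second derivative of
    [S_N] is an explicit oscillating kernel, and then by integrating twice.
    Dividing by [sin x] and integrating over [[0, pi/2]], where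
    [sin ((2n+1) x) / sin x] has integral [pi/2], gives the identity for the
    partial sums up to [O(1/N)]. *)

Require Import Defs.
From Stdlib Require Import Reals Arith Lra Lia.
From Coquelicot Require Import Coquelicot.

Local Open Scope R_scope.

(** * Partial sums of the beta series and of the trigonometric series *)

Definition beta_partial (N j : nat) : R :=
  sum_n (fun n => (-1) ^ n / INR (2 * n + 1) ^ j) N.

Definition sin_partial (N j : nat) (x : R) : R :=
  sum_n (fun n => (-1) ^ n * sin (INR (2 * n + 1) * x) / INR (2 * n + 1) ^ j) N.

Definition cos_partial (N j : nat) (x : R) : R :=
  sum_n (fun n => (-1) ^ n * cos (INR (2 * n + 1) * x) / INR (2 * n + 1) ^ j) N.

Lemma INR_odd (n : nat) : INR (2 * n + 1) = 2 * INR n + 1.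
Proof. rewrite plus_INR, mult_INR; simpl; ring. Qed.

Lemma INR_odd_pos (n : nat) : 0 < INR (2 * n + 1).
Proof. apply lt_0_INR; lia. Qed.

Lemma sum_n_Ropp (u : nat -> R) (N : nat) : sum_n (fun n => - u n) N = - sum_n u N.
Proof.
  induction N as [|N IH]; [now rewrite !sum_O|].
  rewrite !sum_Sn, IH; change (- sum_n u N + - u (S N) = - (sum_n u N + u (S N))); ring.
Qed.

Lemma sin_partial_0 (N j : nat) : sin_partial N j 0 = 0.
Proof.
  unfold sin_partial.
  rewrite (sum_n_ext _ (fun _ => 0)).
  - rewrite sum_n_const; ring.
  - intro n; rewrite Rmult_0_r, sin_0; unfold Rdiv; rewrite Rmult_0_r, Rmult_0_l; reflexivity.
Qed.

Lemma cos_partial_0 (N j : nat) : cos_partial N j 0 = beta_partial N j.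
Proof.
  apply sum_n_ext; intro n; rewrite Rmult_0_r, cos_0, Rmult_1_r; reflexivity.
Qed.

Lemma is_derive_sin_partial (N j : nat) (x : R) :
  is_derive (sin_partial N (S j)) x (cos_partial N j x).
Proof.
  apply (is_derive_sum_n (K := R_AbsRing) (V := R_NormedModule)
    (fun n x => (-1) ^ n * sin (INR (2 * n + 1) * x) / INR (2 * n + 1) ^ S j)).
  intros n _.
  assert (H := INR_odd_pos n).
  assert (H' := pow_lt _ j H).
  revert H H'; generalize (INR (2 * n + 1)); intros a H H'.
  auto_derive; [trivial|].
  simpl; field; lra.
Qed.

Lemma is_derive_cos_partial (N j : nat) (x : R) :
  is_derive (cos_partial N (S j)) x (- sin_partial N j x).
Proof.
  unfold sin_partial; rewrite <- sum_n_Ropp.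
  apply (is_derive_sum_n (K := R_AbsRing) (V := R_NormedModule)
    (fun n x => (-1) ^ n * cos (INR (2 * n + 1) * x) / INR (2 * n + 1) ^ S j)).
  intros n _.
  assert (H := INR_odd_pos n).
  assert (H' := pow_lt _ j H).
  revert H H'; generalize (INR (2 * n + 1)); intros a H H'.
  auto_derive; [trivial|].
  simpl; field; lra.
Qed.

(** Since [2 cos x sin ((2n+1) x) = sin ((2n+2) x) + sin (2n x)], the alternating sum telescopes.
    This is the oscillating kernel: the second derivative of [sin_partial N 2] is
    [- sin_partial N 0]. *)
Lemma sin_partial_order_0 (N : nat) (x : R) :
  2 * cos x * sin_partial N 0 x = (-1) ^ N * sin (2 * INR (S N) * x).
Proof.
  unfold sin_partial; induction N as [|N IH].
  - rewrite sum_O; simpl.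
    replace ((1 + 1) * x) with (2 * x) by ring.
    replace (2 * 1 * x) with (2 * x) by ring.
    rewrite Rmult_1_l, sin_2a; field_simplify; rewrite ?Rmult_1_l; ring.
  - rewrite sum_Sn; change (plus ?a ?b) with (Rplus a b).
    rewrite Rmult_plus_distr_l, IH, INR_odd, !S_INR.
    set (a := (2 * (INR N + 1) + 1) * x).
    replace (2 * (INR N + 1) * x) with (a - x) by (unfold a; ring).
    replace (2 * (INR N + 1 + 1) * x) with (a + x) by (unfold a; ring).
    rewrite sin_plus, sin_minus; simpl; field.
Qed.

(** * Mean value comparison and the estimate for [m = 1] *)

(** For [s = 1] and [s = -1] the function [g - s * f] has a nonnegative derivative, and the mean
    value theorem gives one half of the bound each time. Estimates of integrals below are phrased as
    estimates of derivatives through this lemma. *)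
Lemma MVT_dominated (f g df dg : R -> R) (x : R) :
  0 <= x ->
  (forall t, 0 <= t <= x -> is_derive f t (df t)) ->
  (forall t, 0 <= t <= x -> is_derive g t (dg t)) ->
  (forall t, 0 <= t <= x -> Rabs (df t) <= dg t) ->
  Rabs (f x - f 0) <= g x - g 0.
Proof.
  intros Hx Hf Hg H.
  assert (Hmin : Rmin 0 x = 0) by (apply Rmin_left; lra).
  assert (Hmax : Rmax 0 x = x) by (apply Rmax_right; lra).
  assert (K : forall s, Rabs s = 1 -> 0 <= (g x - g 0) - s * (f x - f 0)).
  { intros s Hs.
    assert (D : forall t, 0 <= t <= x ->
              is_derive (fun t => g t - s * f t) t (dg t - s * df t)).
    { intros t Ht.
      apply (is_derive_minus (K := R_AbsRing) (V := R_NormedModule)); [now apply Hg|].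
      apply is_derive_scal; now apply Hf. }
    destruct (MVT_gen (fun t => g t - s * f t) 0 x (fun t => dg t - s * df t))
      as [c [Hc E]].
    - rewrite Hmin, Hmax; intros t Ht; apply D; lra.
    - rewrite Hmin, Hmax; intros t Ht; apply continuity_pt_filterlim.
      apply (ex_derive_continuous (fun t => g t - s * f t)).
      eexists; apply D; lra.
    - rewrite Hmin, Hmax in Hc.
      replace (g x - g 0 - s * (f x - f 0))
        with ((dg c - s * df c) * (x - 0)) by lra.
      apply Rmult_le_pos; [|lra].
      assert (A := H c Hc).
      assert (B := Rle_abs (s * df c)).
      rewrite Rabs_mult, Hs in B; lra. }
  assert (K1 := K 1 Rabs_R1).
  assert (K2 := K (-1) ltac:(rewrite Rabs_left; lra)).
  apply Rabs_le; lra.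
Qed.

(** The difference of the two sides vanishes at 0 and has derivative [u * sin u], which is
    nonnegative up to [PI]. *)
Lemma mul_cos_le_sin (u : R) : 0 <= u <= PI -> u * cos u <= sin u.
Proof.
  intros Hu.
  assert (H := MVT_dominated (fun _ => 0) (fun t => sin t - t * cos t)
                 (fun _ => 0) (fun t => t * sin t) u ltac:(lra)).
  cbv beta in H; rewrite sin_0, Rminus_0_r, Rabs_R0 in H.
  enough (0 <= sin u - u * cos u - (0 - 0 * cos 0)) by lra.
  apply H; intros t Ht.
  - apply (is_derive_const (K := R_AbsRing) (V := R_NormedModule)).
  - auto_derive; [trivial | ring].
  - apply Rmult_le_pos; [lra | apply sin_ge_0; lra].
Qed.

(** The sign condition that makes [(x - t) / cos t] decreasing in [t]. Replacing [x] by [PI / 2]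
    only enlarges the left side, and [u = PI / 2 - t] then reduces it to [mul_cos_le_sin]. *)
Lemma mul_sin_le_cos (x t : R) :
  0 <= t <= x -> x < PI / 2 -> (x - t) * sin t <= cos t.
Proof.
  intros Ht Hx.
  assert (Hs : 0 <= sin t) by (apply sin_ge_0; lra).
  apply Rle_trans with ((PI / 2 - t) * sin t).
  { apply Rmult_le_compat_r; lra. }
  rewrite <- (sin_shift t), <- (cos_shift t).
  apply mul_cos_le_sin; lra.
Qed.

(* With [h x = sin_partial N 2 x - beta_partial N 1 * x] one has [h 0 = h' 0 = 0]
   and [h'' t = - (-1)^N sin (2 (N + 1) t) / (2 cos t)], so [h x] is the integral
   of [(x - t) h'' t] over [[0, x]].  Since [(x - t) / cos t] is decreasing, one
   integration by parts gains the factor [1 / (N + 1)]. *)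
Lemma sin_partial_2_approx (N : nat) (x : R) :
  0 <= x < PI / 2 ->
  Rabs (sin_partial N 2 x - beta_partial N 1 * x) <= / (2 * INR (S N)) * x.
Proof.
  intros Hx.
  assert (HN : 0 < INR (S N)) by (apply lt_0_INR; lia).
  set (M := INR (S N)) in *.
  set (b := beta_partial N 1).
  set (e := (-1) ^ N).
  assert (He : Rabs e = 1) by (unfold e; apply pow_1_abs).
  assert (Hcos : forall t, 0 <= t <= x -> 0 < cos t)
    by (intros t Ht; apply cos_gt_0; lra).
  set (g := fun t => (x - t) / cos t).
  set (dg := fun t => (- cos t + (x - t) * sin t) / (cos t * cos t)).
  assert (Dg : forall t, 0 <= t <= x -> is_derive g t (dg t)).
  { intros t Ht; assert (Hc := Hcos t Ht); unfold g, dg.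
    auto_derive; [lra | field; lra]. }
  (* The primitive of [2 * M * sin (2 * M * t)] that vanishes at 0. Together with [g x = 0] this
     choice removes both boundary terms of the integration by parts. *)
  set (w := fun t => 1 - cos (2 * M * t)).
  assert (Hw : forall t, 0 <= w t <= 2).
  { intro t; unfold w; generalize (COS_bound (2 * M * t)); lra. }
  (* The dominated function runs from 0 at [t = 0] to [h x] at [t = x]. Since [w <= 2] and
     [dg <= 0], its derivative is bounded by that of [- / (2 * M) * g], which increases in total by
     [g 0 / (2 * M) = x / (2 * M)]. *)
  assert (H := MVT_dominated
    (fun t => (sin_partial N 2 t - b * t) + (x - t) * (cos_partial N 1 t - b)
              + e / (4 * M) * (w t * g t))
    (fun t => - / (2 * M) * g t)
    (fun t => e / (4 * M) * (w t * dg t))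
    (fun t => - / (2 * M) * dg t) x ltac:(lra)).
  cbv beta in H.
  rewrite sin_partial_0, cos_partial_0 in H; fold b in H.
  replace (w 0) with 0 in H by (unfold w; rewrite Rmult_0_r, cos_0; ring).
  replace (g x) with 0 in H by (unfold g; field; apply Rgt_not_eq, Hcos; lra).
  replace (g 0) with x in H by (unfold g; rewrite cos_0; field).
  replace (sin_partial N 2 x - b * x) with
    (sin_partial N 2 x - b * x + (x - x) * (cos_partial N 1 x - b) +
       e / (4 * M) * (w x * 0) -
       (0 - b * 0 + (x - 0) * (b - b) + e / (4 * M) * (0 * x))) by ring.
  replace (/ (2 * M) * x) with (- / (2 * M) * 0 - - / (2 * M) * x) by ring.
  apply H; clear H.
  - intros t Ht; assert (Hc := Hcos t Ht).
    assert (E := sin_partial_order_0 N t); fold M e in E.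
    assert (E' : sin_partial N 0 t = e * sin (2 * M * t) / (2 * cos t)).
    { rewrite <- E; field; lra. }
    (* By [E'], the term [(x - t) * h'' t] cancels the part of the derivative of [w * g] that
       contains [w'], so only [w * dg] survives. *)
    replace (e / (4 * M) * (w t * dg t)) with
      (((cos_partial N 1 t - b) + (- (cos_partial N 1 t - b) + (x - t) * (- sin_partial N 0 t - 0)))
       + e / (4 * M) * (2 * M * sin (2 * M * t) * g t + w t * dg t)).
    2:{ rewrite E'; unfold g; field; lra. }
    assert (D1 : is_derive (fun t => sin_partial N 2 t - b * t) t (cos_partial N 1 t - b)).
    { apply (is_derive_minus (K := R_AbsRing) (V := R_NormedModule)).
      - apply is_derive_sin_partial.
      - auto_derive; [trivial | ring]. }
    assert (D2 : is_derive (fun t => cos_partial N 1 t - b) t (- sin_partial N 0 t - 0)).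
    { apply (is_derive_minus (K := R_AbsRing) (V := R_NormedModule)).
      - apply is_derive_cos_partial.
      - apply (is_derive_const (K := R_AbsRing) (V := R_NormedModule)). }
    assert (D3 : is_derive (fun t => x - t) t (-1)) by (auto_derive; [trivial | ring]).
    assert (D4 : is_derive w t (2 * M * sin (2 * M * t)))
      by (unfold w; auto_derive; [trivial | ring]).
    apply (is_derive_plus (K := R_AbsRing) (V := R_NormedModule)).
    + apply (is_derive_plus (K := R_AbsRing) (V := R_NormedModule)); [exact D1|].
      replace (- (cos_partial N 1 t - b)) with (-1 * (cos_partial N 1 t - b)) by ring.
      apply (is_derive_mult (K := R_AbsRing) (fun t => x - t) (fun t => cos_partial N 1 t - b));
        [exact D3 | exact D2 | exact Rmult_comm].
    + apply is_derive_scal.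
      apply (is_derive_mult (K := R_AbsRing) w g); [exact D4 | now apply Dg | exact Rmult_comm].
  - intros t Ht; apply is_derive_scal; now apply Dg.
  - intros t Ht; assert (Hc := Hcos t Ht).
    assert (Hd : dg t <= 0).
    { unfold dg; assert (K := mul_sin_le_cos x t Ht ltac:(lra)).
      replace ((- cos t + (x - t) * sin t) / (cos t * cos t)) with
        (- ((cos t - (x - t) * sin t) * / (cos t * cos t))) by (field; lra).
      enough (0 <= (cos t - (x - t) * sin t) * / (cos t * cos t)) by lra.
      apply Rmult_le_pos; [lra|].
      left; apply Rinv_0_lt_compat; nra. }
    unfold Rdiv; rewrite !Rabs_mult, He, Rabs_inv.
    rewrite (Rabs_pos_eq (4 * M)), (Rabs_pos_eq (w t)), (Rabs_left1 (dg t))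
      by (try apply Hw; lra).
    replace (- / (2 * M) * dg t) with (/ (4 * M) * (2 * - dg t)) by (field; lra).
    rewrite Rmult_1_l; apply Rmult_le_compat_l.
    + left; apply Rinv_0_lt_compat; lra.
    + apply Rmult_le_compat_r; [lra | apply Hw].
Qed.

(** * Taylor polynomials and the estimate for every [m] *)

(** The polynomial [P_N] with [p = m - 1] and [i = k - 1]: the Taylor polynomial at 0 of
    [sin_partial N (2 * p + 2)]. *)
Definition sin_poly (N p : nat) (x : R) : R :=
  sum_n (fun i => (-1) ^ i * beta_partial N (2 * (p - i) + 1)
                  * (x ^ (2 * i + 1) / INR (fact (2 * i + 1)))) p.

(** The Taylor polynomial of degree [2 * p] at 0 of [cos_partial N (2 * p + 1)]. *)
Definition cos_poly (N p : nat) (x : R) : R :=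
  sum_n (fun i => (-1) ^ i * beta_partial N (2 * (p - i) + 1)
                  * (x ^ (2 * i) / INR (fact (2 * i)))) p.

Lemma is_derive_pow_div_fact (n : nat) (x : R) :
  is_derive (fun x => x ^ S n / INR (fact (S n))) x (x ^ n / INR (fact n)).
Proof.
  assert (H := INR_fact_neq_0 n); assert (H' := not_0_INR (S n) ltac:(lia)).
  rewrite fact_simpl, mult_INR.
  remember (INR (fact n)) as a; remember (INR (S n)) as b eqn:Hb.
  auto_derive; [trivial|].
  change (match n with 0%nat => 1 | S _ => INR n + 1 end) with (INR (S n)).
  rewrite <- Hb; field; auto.
Qed.

Lemma is_derive_sin_poly (N p : nat) (x : R) :
  is_derive (sin_poly N p) x (cos_poly N p x).
Proof.
  apply (is_derive_sum_n (K := R_AbsRing) (V := R_NormedModule)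
    (fun i x => (-1) ^ i * beta_partial N (2 * (p - i) + 1)
                  * (x ^ (2 * i + 1) / INR (fact (2 * i + 1))))).
  intros i _; apply is_derive_scal.
  replace (2 * i + 1)%nat with (S (2 * i)) by lia; apply is_derive_pow_div_fact.
Qed.

(** Isolates the constant term, which differentiation kills. After the index shift [S p - S i] is
    [p - i], so the remaining sum differentiates term by term to [- sin_poly N p]. *)
Lemma cos_poly_S (N p : nat) (x : R) :
  cos_poly N (S p) x = beta_partial N (2 * S p + 1) +
  sum_n (fun i => (-1) ^ S i * beta_partial N (2 * (p - i) + 1)
                  * (x ^ (2 * S i) / INR (fact (2 * S i)))) p.
Proof.
  unfold cos_poly, sum_n.
  rewrite sum_Sn_m, <- sum_n_m_S by lia.
  change (plus ?a ?b) with (Rplus a b); f_equal.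
  rewrite Nat.sub_0_r; simpl; field.
Qed.

Lemma is_derive_cos_poly (N p : nat) (x : R) :
  is_derive (cos_poly N (S p)) x (- sin_poly N p x).
Proof.
  apply (is_derive_ext (V := R_NormedModule) (K := R_AbsRing)) with (1 := fun t => eq_sym (cos_poly_S N p t)).
  unfold sin_poly; rewrite <- sum_n_Ropp, <- Rplus_0_l.
  apply (is_derive_plus (K := R_AbsRing) (V := R_NormedModule)).
  - apply (is_derive_const (K := R_AbsRing) (V := R_NormedModule)).
  - apply (is_derive_sum_n (K := R_AbsRing) (V := R_NormedModule)
      (fun i x => (-1) ^ S i * beta_partial N (2 * (p - i) + 1)
                  * (x ^ (2 * S i) / INR (fact (2 * S i))))).
    intros i _.
    replace (- ((-1) ^ i * beta_partial N (2 * (p - i) + 1)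
                  * (x ^ (2 * i + 1) / INR (fact (2 * i + 1)))))
      with ((-1) ^ S i * beta_partial N (2 * (p - i) + 1)
                  * (x ^ (2 * i + 1) / INR (fact (2 * i + 1))))
      by (simpl pow at 1; ring).
    apply is_derive_scal.
    replace (2 * S i)%nat with (S (2 * i + 1)) by lia; apply is_derive_pow_div_fact.
Qed.

Lemma sin_poly_0 (N p : nat) : sin_poly N p 0 = 0.
Proof.
  unfold sin_poly.
  rewrite (sum_n_ext _ (fun _ => 0)).
  - rewrite sum_n_const; ring.
  - intro i; rewrite pow_i by lia; unfold Rdiv; rewrite Rmult_0_l, Rmult_0_r; reflexivity.
Qed.

Lemma cos_poly_0 (N p : nat) : cos_poly N p 0 = beta_partial N (2 * p + 1).
Proof.
  destruct p as [|p].
  - unfold cos_poly; rewrite sum_O; simpl; field.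
  - rewrite cos_poly_S, (sum_n_ext _ (fun _ => 0)).
    + rewrite sum_n_const; ring.
    + intro i; rewrite pow_i by lia; unfold Rdiv; rewrite Rmult_0_l, Rmult_0_r; reflexivity.
Qed.

Lemma MVT_abs_bound (f df : R -> R) (K x : R) :
  0 <= x -> f 0 = 0 ->
  (forall t, 0 <= t <= x -> is_derive f t (df t)) ->
  (forall t, 0 <= t <= x -> Rabs (df t) <= K) ->
  Rabs (f x) <= K * x.
Proof.
  intros Hx H0 Hf H.
  assert (A := MVT_dominated f (fun t => K * t) df (fun _ => K) x Hx Hf).
  rewrite H0, !Rminus_0_r in A; cbv beta in A; rewrite Rmult_0_r, Rminus_0_r in A.
  apply A; [|exact H].
  intros t _; auto_derive; [trivial | ring].
Qed.

(** Each induction step integrates twice from 0, where the sums and their Taylor polynomials agree.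
    Each integration costs a factor of at most 2, because [t < PI / 2 <= 2]; hence [4 ^ p]. The
    factor [x] is kept so that the bound stays integrable after division by [sin x]. *)
Lemma sin_partial_approx (N p : nat) (x : R) :
  0 <= x < PI / 2 ->
  Rabs (sin_partial N (2 * p + 2) x - sin_poly N p x)
    <= 4 ^ p / (2 * INR (S N)) * x.
Proof.
  assert (HN : 0 < INR (S N)) by (apply lt_0_INR; lia).
  assert (Hpi : PI / 2 <= 2) by (generalize PI_4; lra).
  revert x; induction p as [|p IH]; intros x Hx.
  - replace (sin_poly N 0 x) with (beta_partial N 1 * x)
      by (unfold sin_poly; rewrite sum_O; simpl; field).
    unfold Rdiv; rewrite pow_O, Rmult_1_l; now apply sin_partial_2_approx.
  - set (K := 4 ^ p / (2 * INR (S N))) in *.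
    assert (HK : 0 < K).
    { unfold K, Rdiv; apply Rmult_lt_0_compat; [apply pow_lt; lra|].
      apply Rinv_0_lt_compat; lra. }
    replace (4 ^ S p / (2 * INR (S N))) with (4 * K) by (unfold K; rewrite <- tech_pow_Rmult; field; lra).
    replace (2 * S p + 2)%nat with (S (S (2 * p + 2))) by lia.
    assert (B : forall t, 0 <= t < PI / 2 ->
      Rabs (cos_partial N (S (2 * p + 2)) t - cos_poly N (S p) t) <= 2 * K * t).
    { intros t Ht.
      apply (MVT_abs_bound
        (fun t => cos_partial N (S (2 * p + 2)) t - cos_poly N (S p) t)
        (fun t => - sin_partial N (2 * p + 2) t - - sin_poly N p t)); [lra | | | ].
      - rewrite cos_partial_0, cos_poly_0.
        replace (S (2 * p + 2)) with (2 * S p + 1)%nat by lia; ring.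
      - intros u _; apply (is_derive_minus (K := R_AbsRing) (V := R_NormedModule)).
        + apply is_derive_cos_partial.
        + apply is_derive_cos_poly.
      - intros u Hu.
        replace (- sin_partial N (2 * p + 2) u - - sin_poly N p u)
          with (- (sin_partial N (2 * p + 2) u - sin_poly N p u)) by ring.
        rewrite Rabs_Ropp.
        apply Rle_trans with (K * u); [apply IH; lra | nra]. }
    apply (MVT_abs_bound
      (fun t => sin_partial N (S (S (2 * p + 2))) t - sin_poly N (S p) t)
      (fun t => cos_partial N (S (2 * p + 2)) t - cos_poly N (S p) t)); [lra | | | ].
    + rewrite sin_partial_0, sin_poly_0; ring.
    + intros u _; apply (is_derive_minus (K := R_AbsRing) (V := R_NormedModule)).
      * apply is_derive_sin_partial.
      * apply is_derive_sin_poly.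
    + intros u Hu; apply Rle_trans with (2 * K * u); [apply B; lra | nra].
Qed.

(* [ring] and [field] do not see through the carriers of Coquelicot's structures. *)
Ltac eq_in_R := match goal with |- @eq _ ?l ?r => change (@eq R l r) end.

(** * Integrals over [[0, PI / 2]] *)

(** Passing from [n] to [n + 1] adds [2 cos ((2n+2) x)] to the integrand, and its integral vanishes
    because [sin ((n+1) PI) = 0]. *)
Lemma is_RInt_sin_ratio (n : nat) :
  is_RInt (fun x => sin (INR (2 * n + 1) * x) / sin x) 0 (PI / 2) (PI / 2).
Proof.
  assert (Hpi := PI_RGT_0).
  assert (Hsin : forall x, Rmin 0 (PI / 2) < x < Rmax 0 (PI / 2) -> 0 < sin x).
  { intros x; rewrite Rmin_left, Rmax_right by lra; intro Hx; apply sin_gt_0; lra. }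
  induction n as [|n IH].
  - replace (PI / 2) with (scal (PI / 2 - 0) 1) at 2
      by (unfold scal; simpl; unfold mult; simpl; ring).
    apply is_RInt_ext with (2 := is_RInt_const (V := R_NormedModule) 0 (PI / 2) 1).
    intros x Hx; apply Hsin in Hx.
    simpl; rewrite Rmult_1_l; eq_in_R; field; lra.
  - set (c := 2 * INR n + 2).
    assert (Hc : 0 < c) by (unfold c; generalize (pos_INR n); lra).
    assert (D : is_RInt (fun x => 2 * cos (c * x)) 0 (PI / 2)
                  (2 / c * sin (c * (PI / 2)) - 2 / c * sin (c * 0))).
    { apply (is_RInt_derive (V := R_CompleteNormedModule) (fun x => 2 / c * sin (c * x)));
        intros x _.
      - auto_derive; [trivial | field; lra].
      - apply (ex_derive_continuous (fun x => 2 * cos (c * x))).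
        auto_derive; trivial. }
    replace (sin (c * (PI / 2))) with 0 in D.
    2:{ replace (c * (PI / 2)) with (INR (S n) * PI)
          by (unfold c; rewrite S_INR; field).
        symmetry; apply sin_eq_0_1; exists (Z.of_nat (S n)).
        rewrite <- INR_IZR_INZ; ring. }
    rewrite (Rmult_0_r c), sin_0, Rmult_0_r, Rminus_0_r in D.
    assert (K := is_RInt_plus _ _ _ _ _ _ IH D).
    change (plus (PI / 2) 0) with (PI / 2 + 0) in K; rewrite Rplus_0_r in K.
    revert K; apply is_RInt_ext.
    intros x Hx; apply Hsin in Hx.
    change (plus ?a ?b) with (Rplus a b).
    rewrite !INR_odd, S_INR.
    replace ((2 * (INR n + 1) + 1) * x) with (c * x + x) by (unfold c; ring).
    replace ((2 * INR n + 1) * x) with (c * x - x) by (unfold c; ring).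
    rewrite sin_plus, sin_minus; eq_in_R; field; lra.
Qed.

(** The continuous extension of [x / sin x], whose value at 0 would be 0 under the convention for
    division. *)
Definition inv_sinc (x : R) : R := if Req_EM_T x 0 then 1 else x / sin x.

Lemma continuous_inv_sinc (x : R) : 0 <= x < PI -> continuous inv_sinc x.
Proof.
  intros Hx.
  destruct (Req_dec x 0) as [->|Hx0].
  - assert (L : is_lim (fun y => / (sin y / y)) 0 1).
    { replace (Finite 1) with (Rbar_inv 1) by (simpl; f_equal; apply Rinv_1).
      apply is_lim_inv; [exact is_lim_sinc_0|].
      intro E; injection E; lra. }
    apply is_lim_spec in L.
    apply filterlim_locally; intro eps.
    destruct (L eps) as [d Hd].
    exists d; intros y Hy.
    unfold inv_sinc at 1; destruct (Req_EM_T 0 0) as [_|]; [|lra].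
    unfold inv_sinc; destruct (Req_EM_T y 0) as [E|E].
    + apply ball_center.
    + specialize (Hd y Hy E).
      change (Rabs (y / sin y - 1) < eps).
      replace (y / sin y) with (/ (sin y / y)); [exact Hd|].
      unfold Rdiv; rewrite Rinv_mult, Rinv_inv; ring.
  - assert (Hs : 0 < sin x) by (apply sin_gt_0; lra).
    apply continuous_ext_loc with (fun y => y / sin y).
    (* The ball of radius [x] about [x] excludes 0. *)
    + exists (mkposreal x ltac:(lra)); intros y Hy.
      unfold inv_sinc; destruct (Req_EM_T y 0) as [E|E]; [|reflexivity].
      exfalso; subst y; revert Hy.
      change (Rabs (0 - x) < x -> False).
      rewrite Rabs_left; lra.
    + apply (ex_derive_continuous (fun y => y / sin y)).
      auto_derive; lra.
Qed.

(** Inside the interval [x > 0], so the integrand equals the continuous [x ^ i * inv_sinc x]: the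
    singularity at 0 is removable. *)
Lemma ex_RInt_pow_div_sin (i : nat) (a b : R) :
  0 <= a < PI -> 0 <= b < PI -> ex_RInt (fun x => x ^ S i / sin x) a b.
Proof.
  intros Ha Hb.
  assert (Hm : 0 <= Rmin a b) by (apply Rmin_glb; lra).
  assert (HM : Rmax a b < PI) by (apply Rmax_lub_lt; lra).
  apply ex_RInt_ext with (fun x => x ^ i * inv_sinc x).
  - intros x Hx; unfold inv_sinc; destruct (Req_EM_T x 0) as [E|E]; [lra|].
    simpl; unfold Rdiv; eq_in_R; ring.
  - apply (ex_RInt_continuous (V := R_CompleteNormedModule)); intros x Hx.
    apply (continuous_mult (K := R_AbsRing) (fun x => x ^ i) inv_sinc).
    + apply (ex_derive_continuous (fun x => x ^ i)); auto_derive; trivial.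
    + apply continuous_inv_sinc; lra.
Qed.

Definition sin_moment (i : nat) : R := RInt (fun x => x ^ i / sin x) 0 (PI / 2).

Lemma is_RInt_sin_moment (i : nat) :
  is_RInt (fun x => x ^ S i / sin x) 0 (PI / 2) (sin_moment (S i)).
Proof.
  apply (RInt_correct (V := R_CompleteNormedModule)), ex_RInt_pow_div_sin;
    generalize PI_RGT_0; lra.
Qed.

Lemma is_RInt_sum_n (f : nat -> R -> R) (I : nat -> R) (a b : R) (n : nat) :
  (forall i, is_RInt (f i) a b (I i)) ->
  is_RInt (fun x => sum_n (fun i => f i x) n) a b (sum_n I n).
Proof.
  intro H; induction n as [|n IH].
  - rewrite sum_O; apply is_RInt_ext with (2 := H O).
    intros x _; now rewrite sum_O.
  - rewrite sum_Sn.
    apply is_RInt_ext with (2 := is_RInt_plus _ _ _ _ _ _ IH (H (S n))).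
    intros x _; now rewrite sum_Sn.
Qed.

Lemma sum_n_Rmult_r (u : nat -> R) (c : R) (n : nat) :
  sum_n (fun i => u i * c) n = sum_n u n * c.
Proof. exact (sum_n_mult_r (K := R_Ring) c u n). Qed.

(** This is [sin_partial_approx] divided by [sin x] and integrated; the majorant [K * x / sin x] has
    integral [K * sin_moment 1]. *)
Lemma beta_partial_approx (N p : nat) :
  Rabs (beta_partial N (2 * p + 2) * (PI / 2)
        - sum_n (fun i => (-1) ^ i * beta_partial N (2 * (p - i) + 1)
                 * (sin_moment (2 * i + 1) / INR (fact (2 * i + 1)))) p)
    <= 4 ^ p / (2 * INR (S N)) * sin_moment 1.
Proof.
  assert (Hpi := PI_RGT_0).
  set (K := 4 ^ p / (2 * INR (S N))).
  set (b := beta_partial N (2 * p + 2) * (PI / 2)).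
  match goal with |- Rabs (b - ?x) <= _ => set (s := x) end.
  assert (A : is_RInt (fun x => sin_partial N (2 * p + 2) x / sin x) 0 (PI / 2) b).
  { unfold b, beta_partial; rewrite <- sum_n_Rmult_r.
    apply is_RInt_ext with (2 := is_RInt_sum_n
      (fun n x => (-1) ^ n / INR (2 * n + 1) ^ (2 * p + 2) *
                       (sin (INR (2 * n + 1) * x) / sin x)) _ _ _ N
      (fun n => is_RInt_scal _ _ _ ((-1) ^ n / INR (2 * n + 1) ^ (2 * p + 2))
                  _ (is_RInt_sin_ratio n))).
    intros x _; unfold sin_partial, Rdiv; rewrite <- sum_n_Rmult_r.
    apply sum_n_ext; intro n.
    eq_in_R; unfold Rdiv; ring. }
  assert (B : is_RInt (fun x => sin_poly N p x / sin x) 0 (PI / 2) s).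
  { assert (C : forall i, is_RInt
      (fun x => (-1) ^ i * beta_partial N (2 * (p - i) + 1) / INR (fact (2 * i + 1))
                * (x ^ (2 * i + 1) / sin x)) 0 (PI / 2)
      ((-1) ^ i * beta_partial N (2 * (p - i) + 1)
         * (sin_moment (2 * i + 1) / INR (fact (2 * i + 1))))).
    { intro i.
      replace ((-1) ^ i * beta_partial N (2 * (p - i) + 1)
         * (sin_moment (2 * i + 1) / INR (fact (2 * i + 1)))) with
        ((-1) ^ i * beta_partial N (2 * (p - i) + 1) / INR (fact (2 * i + 1))
         * sin_moment (2 * i + 1)) by (unfold Rdiv; ring).
      apply (is_RInt_scal (V := R_NormedModule) (fun x => x ^ (2 * i + 1) / sin x)).
      rewrite Nat.add_1_r; apply is_RInt_sin_moment. }
    apply is_RInt_ext with (2 := is_RInt_sum_n _ _ _ _ p C).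
    intros x _; unfold sin_poly, Rdiv; rewrite <- sum_n_Rmult_r.
    apply sum_n_ext; intro i; eq_in_R; ring. }
  assert (D : is_RInt (fun x => sin_partial N (2 * p + 2) x / sin x
                                - sin_poly N p x / sin x) 0 (PI / 2) (b - s))
    by apply (is_RInt_minus _ _ _ _ _ _ A B).
  assert (E : forall c, is_RInt (fun x => c * (x ^ 1 / sin x)) 0 (PI / 2) (c * sin_moment 1))
    by (intro c; apply (is_RInt_scal (V := R_NormedModule)), is_RInt_sin_moment).
  (* The open interval suffices for comparing integrals; it avoids [sin 0 = 0] and the endpoint
     [PI / 2], which [sin_partial_approx] excludes. *)
  assert (F : forall x, 0 < x < PI / 2 ->
    Rabs (sin_partial N (2 * p + 2) x / sin x - sin_poly N p x / sin x)
      <= K * (x ^ 1 / sin x)).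
  { intros x Hx.
    assert (Hs : 0 < sin x) by (apply sin_gt_0; lra).
    replace (sin_partial N (2 * p + 2) x / sin x - sin_poly N p x / sin x) with
      ((sin_partial N (2 * p + 2) x - sin_poly N p x) * / sin x) by (unfold Rdiv; ring).
    rewrite Rabs_mult, Rabs_inv, (Rabs_pos_eq (sin x)), pow_1 by lra.
    unfold Rdiv; rewrite <- Rmult_assoc.
    apply Rmult_le_compat_r; [left; now apply Rinv_0_lt_compat|].
    apply sin_partial_approx; lra. }
  rewrite <- (is_RInt_unique _ _ _ _ D).
  assert (G := is_RInt_unique _ _ _ _ (E K)).
  assert (G' := is_RInt_unique _ _ _ _ (E (- K))).
  apply Rabs_le; split.
  - replace (- (K * sin_moment 1)) with (- K * sin_moment 1) by ring; rewrite <- G'.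
    apply RInt_le; [lra | eexists; apply E | eexists; apply D |].
    intros x Hx; specialize (F x Hx); apply Rabs_le_between in F; lra.
  - rewrite <- G.
    apply RInt_le; [lra | eexists; apply D | eexists; apply E |].
    intros x Hx; specialize (F x Hx); apply Rabs_le_between in F; lra.
Qed.

(** * Passage to the limit in [N] *)

(** Leibniz's criterion, which also covers the exponent 1, where convergence is only conditional.
    Writing the exponent as [S j] makes the terms tend to 0. *)
Lemma ex_lim_beta_partial (j : nat) :
  exists l : R, is_lim_seq (fun N => beta_partial N (S j)) l.
Proof.
  destruct (alternated_series (fun n => / INR (2 * n + 1) ^ S j)) as [l Hl].
  - intro n.
    assert (H := INR_odd_pos n).
    apply Rinv_le_contravar; [now apply pow_lt|].
    apply pow_incr; split; [lra | apply le_INR; lia].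
  - apply is_lim_seq_Reals.
    apply is_lim_seq_le_le with (fun _ => 0) (fun n => / INR (S n)).
    + intro n.
      assert (H := INR_odd_pos n); assert (H' := pow_lt _ (S j) H).
      split; [left; now apply Rinv_0_lt_compat|].
      apply Rinv_le_contravar; [apply lt_0_INR; lia|].
      apply Rle_trans with (INR (2 * n + 1)); [apply le_INR; lia|].
      rewrite <- (pow_1 (INR (2 * n + 1))) at 1.
      apply Rle_pow; [apply (le_INR 1); lia | lia].
    + apply is_lim_seq_const.
    + replace (Finite 0) with (Rbar_inv p_infty) by reflexivity.
      apply is_lim_seq_inv; [|discriminate].
      apply is_lim_seq_incr_1 with (u := INR), is_lim_seq_INR.
  - exists l; apply is_lim_seq_Reals in Hl.
    apply is_lim_seq_ext with (2 := Hl).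
    intro N; unfold beta_partial; rewrite <- sum_n_Reals; reflexivity.
Qed.

Definition beta_nat (j : nat) : R := real (Lim_seq (fun N => beta_partial N j)).

Lemma is_lim_beta_partial (j : nat) :
  (1 <= j)%nat -> is_lim_seq (fun N => beta_partial N j) (beta_nat j).
Proof.
  intro Hj; destruct j as [|j]; [lia|].
  destruct (ex_lim_beta_partial j) as [l Hl].
  unfold beta_nat; rewrite (is_lim_seq_unique _ _ Hl); exact Hl.
Qed.

Lemma is_lim_seq_sum_n (u : nat -> nat -> R) (l : nat -> R) (p : nat) :
  (forall i, is_lim_seq (u i) (l i)) ->
  is_lim_seq (fun N => sum_n (fun i => u i N) p) (sum_n l p).
Proof.
  intro H; induction p as [|p IH].
  - rewrite sum_O; apply is_lim_seq_ext with (2 := H O).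
    intro N; now rewrite sum_O.
  - rewrite sum_Sn.
    apply is_lim_seq_ext with (2 := is_lim_seq_plus' _ _ _ _ IH (H (S p))).
    intro N; now rewrite sum_Sn.
Qed.

(** The difference of the two sides for partial sums tends to 0 by [beta_partial_approx], and also
    to the difference of the limits. *)
Lemma beta_nat_even (p : nat) :
  beta_nat (2 * p + 2) * (PI / 2) =
  sum_n (fun i => (-1) ^ i * beta_nat (2 * (p - i) + 1)
                  * (sin_moment (2 * i + 1) / INR (fact (2 * i + 1)))) p.
Proof.
  set (v := fun N => sum_n (fun i => (-1) ^ i * beta_partial N (2 * (p - i) + 1)
                 * (sin_moment (2 * i + 1) / INR (fact (2 * i + 1)))) p).
  assert (Hv : is_lim_seq v (sum_n (fun i => (-1) ^ i * beta_nat (2 * (p - i) + 1)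
                  * (sin_moment (2 * i + 1) / INR (fact (2 * i + 1)))) p)).
  { apply (is_lim_seq_sum_n (fun i N => (-1) ^ i * beta_partial N (2 * (p - i) + 1)
                 * (sin_moment (2 * i + 1) / INR (fact (2 * i + 1))))).
    intro i.
    apply is_lim_seq_mult'; [apply is_lim_seq_mult'|]; try apply is_lim_seq_const.
    apply is_lim_beta_partial; lia. }
  assert (Hu : is_lim_seq (fun N => beta_partial N (2 * p + 2) * (PI / 2))
                 (beta_nat (2 * p + 2) * (PI / 2))).
  { apply is_lim_seq_mult'; [|apply is_lim_seq_const].
    apply is_lim_beta_partial; lia. }
  assert (Hd : is_lim_seq (fun N => beta_partial N (2 * p + 2) * (PI / 2) - v N) 0).
  { apply is_lim_seq_abs_0.
    apply is_lim_seq_le_le with (fun _ => 0)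
      (fun N => (4 ^ p / 2 * sin_moment 1) * / INR (S N)).
    - intro N; split; [apply Rabs_pos|].
      apply Rle_trans with (1 := beta_partial_approx N p); right.
      assert (H := not_0_INR (S N) ltac:(lia)); field; exact H.
    - apply is_lim_seq_const.
    - replace (Finite 0) with (Finite (4 ^ p / 2 * sin_moment 1 * 0)) by (f_equal; ring).
      apply is_lim_seq_mult'; [apply is_lim_seq_const|].
      replace (Finite 0) with (Rbar_inv p_infty) by reflexivity.
      apply is_lim_seq_inv; [|discriminate].
      apply is_lim_seq_incr_1 with (u := INR), is_lim_seq_INR. }
  assert (K := is_lim_seq_unique _ _ (is_lim_seq_minus' _ _ _ _ Hu Hv)).
  apply is_lim_seq_unique in Hd.
  cbv beta in K; rewrite Hd in K; injection K as K.
  apply Rminus_diag_uniq; symmetry; exact K.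
Qed.

(** * From real to complex sums and integrals *)

Lemma cpower_RtoC (x r : R) : cpower x (RtoC r) = RtoC (Rpower x r).
Proof.
  unfold cpower; rewrite <- RtoC_mult; unfold Cexp, Rpower, RtoC; simpl.
  rewrite cos_0, sin_0, Rmult_1_r, Rmult_0_r; reflexivity.
Qed.

Lemma sum_n_RtoC (u : nat -> R) (n : nat) :
  sum_n (G := C_AbelianMonoid) (fun k => RtoC (u k)) n = RtoC (sum_n u n).
Proof.
  induction n as [|n IH]; [now rewrite !sum_O|].
  rewrite !sum_Sn, IH; symmetry; apply RtoC_plus.
Qed.

Lemma filterlim_RtoC {T : Type} (F : (T -> Prop) -> Prop) {FF : Filter F}
    (u : T -> R) (l : R) :
  filterlim u F (locally l) ->
  filterlim (fun t => RtoC (u t)) F (locally (T := C_UniformSpace) (RtoC l)).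
Proof.
  intro H; apply filterlim_locally; intro eps.
  apply filter_imp with (2 := proj1 (filterlim_locally u l) H eps).
  intros t Ht; split; [exact Ht | apply ball_center].
Qed.

(** [CSeries] selects its value by [iota], so convergence must be accompanied by uniqueness of the
    limit in [C]. *)
Lemma beta_INR (j : nat) :
  (1 <= j)%nat -> beta (RtoC (INR j)) = RtoC (beta_nat j).
Proof.
  intro Hj; unfold beta, CSeries.
  assert (H : is_series (V := C_NormedModule)
    (fun n : nat => (RtoC ((-1) ^ n) * cpower (INR (2 * n + 1)) (- RtoC (INR j)))%C)
    (RtoC (beta_nat j))).
  { apply filterlim_ext with (fun N => RtoC (beta_partial N j)).
    - intro N; unfold beta_partial.
      rewrite <- sum_n_RtoC; apply sum_n_ext; intro n.
      rewrite <- RtoC_opp, cpower_RtoC, Rpower_Ropp, Rpower_pow by apply INR_odd_pos.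
      now rewrite <- RtoC_mult.
    - apply filterlim_RtoC; [apply eventually_filter | apply is_lim_beta_partial, Hj]. }
  apply (iota_unique (V := C_CompleteNormedModule)); [|exact H].
  intros y Hy.
  exact (filterlim_locally_unique (V := C_NormedModule) _ _ _ Hy H).
Qed.

(** Integration is componentwise, and the imaginary component is the integral of 0. *)
Lemma is_RInt_gen_RtoC (Fa Fb : (R -> Prop) -> Prop) {FFa : Filter Fa} {FFb : Filter Fb}
    (f : R -> R) (l : R) :
  is_RInt_gen f Fa Fb l ->
  is_RInt_gen (V := C_R_NormedModule) (fun x => RtoC (f x)) Fa Fb (RtoC l).
Proof.
  intro H; apply filterlimi_locally; intro eps.
  apply filter_imp with (2 := proj1 (filterlimi_locally _ _) H eps).
  intros [a b] [z [Hz Hb]]; exists (RtoC z); split.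
  - apply (is_RInt_fct_extend_pair (U := R_NormedModule) (V := R_NormedModule));
      [exact Hz|].
    assert (K : is_RInt (fun _ => 0) a b ((b - a) * 0))
      by apply (is_RInt_const (V := R_NormedModule)).
    rewrite Rmult_0_r in K; exact K.
  - split; [exact Hb | apply ball_center].
Qed.

(** * Gamma at positive integers *)

(** The primitive of [t ^ n * exp (- t)] that vanishes at infinity; the recursion is integration by
    parts. *)
Fixpoint gamma_primitive (n : nat) (t : R) : R :=
  match n with
  | O => - exp (- t)
  | S n => - (t ^ S n * exp (- t)) + INR (S n) * gamma_primitive n t
  end.

Lemma is_derive_gamma_primitive (n : nat) (t : R) :
  is_derive (gamma_primitive n) t (t ^ n * exp (- t)).
Proof.
  induction n as [|n IH].
  - unfold gamma_primitive; auto_derive; [trivial | simpl; ring].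
  - replace (t ^ S n * exp (- t)) with
      ((t ^ S n - INR (S n) * t ^ n) * exp (- t) + INR (S n) * (t ^ n * exp (- t))) by ring.
    apply (is_derive_plus (K := R_AbsRing) (V := R_NormedModule)
      (fun t => - (t ^ S n * exp (- t))) (fun t => INR (S n) * gamma_primitive n t)).
    + remember (INR (S n)) as c eqn:Hc.
      auto_derive; [trivial|].
      change (match n with 0%nat => 1 | S _ => INR n + 1 end) with (INR (S n)).
      rewrite <- Hc; simpl; ring.
    + now apply is_derive_scal.
Qed.

Lemma gamma_primitive_0 (n : nat) : gamma_primitive n 0 = - INR (fact n).
Proof.
  induction n as [|n IH].
  - simpl; rewrite Ropp_0, exp_0; reflexivity.
  - unfold gamma_primitive; fold gamma_primitive.
    rewrite IH, fact_simpl, mult_INR, pow_i by lia; ring.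
Qed.

(* [t^j e^(-t) = c^c (u e^(-u))^c / t] with [c = j + 1] and [u = t / c], and
   [u e^(-u) <= 1]. *)
Lemma is_lim_pow_mul_exp (j : nat) : is_lim (fun t => t ^ j * exp (- t)) p_infty 0.
Proof.
  set (c := INR (S j)).
  assert (Hc : 0 < c) by (apply lt_0_INR; lia).
  apply is_lim_le_le_loc with (fun _ => 0) (fun t => c ^ S j * / t).
  - exists 0; intros t Ht; split.
    + apply Rmult_le_pos; [apply pow_le; lra | left; apply exp_pos].
    + assert (Hu : 0 < t / c) by (apply Rdiv_lt_0_compat; lra).
      set (u := t / c) in *.
      assert (Hue : 0 <= u * exp (- u) <= 1).
      { assert (E := exp_ineq1 u ltac:(lra)); assert (Hp := exp_pos u).
        rewrite exp_Ropp; split.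
        - apply Rmult_le_pos; [lra | left; now apply Rinv_0_lt_compat].
        - apply Rmult_le_reg_r with (exp u); [exact Hp|].
          rewrite Rmult_assoc, Rinv_l; lra. }
      assert (Hexp : exp (- t) = exp (- u) ^ S j).
      { rewrite <- Rpower_pow by apply exp_pos.
        unfold Rpower; rewrite ln_exp; f_equal; fold c; unfold u; field; lra. }
      replace (t ^ j * exp (- t)) with ((c ^ S j * / t) * (u * exp (- u)) ^ S j).
      * rewrite <- (Rmult_1_r (c ^ S j * / t)) at 2.
        apply Rmult_le_compat_l.
        -- apply Rmult_le_pos; [apply pow_le; lra | left; now apply Rinv_0_lt_compat].
        -- rewrite <- (pow1 (S j)); now apply pow_incr.
      * rewrite Hexp, Rpow_mult_distr.
        replace (t ^ j) with (/ t * (c * u) ^ S j).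
        -- rewrite Rpow_mult_distr; ring.
        -- replace (c * u) with t by (unfold u; field; lra).
           simpl; field; lra.
  - apply is_lim_const.
  - replace (Finite 0) with (Rbar_mult (c ^ S j) (Rbar_inv p_infty))
      by (simpl; f_equal; ring).
    apply is_lim_scal_l, is_lim_inv; [apply is_lim_id | discriminate].
Qed.

Lemma is_lim_gamma_primitive (n : nat) : is_lim (gamma_primitive n) p_infty 0.
Proof.
  induction n as [|n IH].
  - apply is_lim_ext with (fun t => - (t ^ 0 * exp (- t))); [intro t; simpl; ring|].
    replace (Finite 0) with (Rbar_opp 0) by (simpl; f_equal; ring).
    apply is_lim_opp, is_lim_pow_mul_exp.
  - replace (Finite 0) with (Finite (- 0 + INR (S n) * 0)) by (f_equal; ring).
    apply (is_lim_plus' (fun t => - (t ^ S n * exp (- t)))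
             (fun t => INR (S n) * gamma_primitive n t)).
    + apply (is_lim_opp _ _ 0), is_lim_pow_mul_exp.
    + apply (is_lim_scal_l _ _ _ 0), IH.
Qed.

(** The primitive rises from [- n!] at 0 to 0 at infinity. *)
Lemma is_RInt_gen_gamma (n : nat) :
  is_RInt_gen (fun t => t ^ n * exp (- t)) (at_right 0) (Rbar_locally p_infty) (INR (fact n)).
Proof.
  assert (D : forall t, Derive (gamma_primitive n) t = t ^ n * exp (- t))
    by (intro t; apply is_derive_unique, is_derive_gamma_primitive).
  apply is_RInt_gen_ext with (Derive (gamma_primitive n)).
  { apply filter_forall; intros ab t _; apply D. }
  replace (INR (fact n)) with (0 - - INR (fact n)) by ring.
  apply (is_RInt_gen_Derive (Fa := at_right 0) (Fb := Rbar_locally p_infty)).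
  - apply filter_forall; intros ab t _; eexists; apply is_derive_gamma_primitive.
  - apply filter_forall; intros ab t _.
    apply continuous_ext with (1 := fun t => eq_sym (D t)).
    apply (ex_derive_continuous (fun t => t ^ n * exp (- t))); auto_derive; trivial.
  - rewrite <- gamma_primitive_0.
    assert (C : continuous (gamma_primitive n) 0)
      by (apply (ex_derive_continuous (gamma_primitive n));
          eexists; apply is_derive_gamma_primitive).
    intros P HP; destruct (C P HP) as [e He]; exists e; auto.
  - apply (is_lim_gamma_primitive n).
Qed.

Lemma Gamma_INR (n : nat) : Gamma (RtoC (INR n) + 1)%C = RtoC (INR (fact n)).
Proof.
  unfold Gamma, CRInt_gen.
  apply (is_RInt_gen_unique (V := C_R_CompleteNormedModule)).
  apply (is_RInt_gen_ext (V := C_R_NormedModule)) with (fun t => RtoC (t ^ n * exp (- t))).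
  (* Positive endpoints force [t > 0] in between, where [cpower] agrees with the natural power. *)
  - apply Filter_prod with (fun a => 0 < a) (fun b => 0 < b).
    + exists (mkposreal 1 Rlt_0_1); intros y _ Hy; exact Hy.
    + exists 0; auto.
    + intros a b Ha Hb t Ht; simpl in Ht.
      assert (Ht' : 0 < t) by (apply Rlt_trans with (2 := proj1 Ht); now apply Rmin_glb_lt).
      replace (RtoC (INR n) + 1 - 1)%C with (RtoC (INR n)) by ring.
      rewrite cpower_RtoC, Rpower_pow by exact Ht'; apply RtoC_mult.
  - apply is_RInt_gen_RtoC; [apply at_right_proper_filter | apply Rbar_locally_filter |].
    apply is_RInt_gen_gamma.
Qed.

(** * The integral [J] at positive integers *)

(** A Riemann integrable function is bounded, so the missing piece over [[a, x]] is at most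
    [(x - a) * B] and tends to 0. This identifies the improper integral in [J] with [sin_moment]. *)
Lemma is_RInt_gen_at_right (f : R -> R) (a b l : R) :
  a < b -> is_RInt f a b l -> is_RInt_gen f (at_right a) (at_point b) l.
Proof.
  intros Hab H.
  assert (Hex : ex_RInt f a b) by now exists l.
  destruct (ex_RInt_ub f a b Hex) as [M HM].
  rewrite Rmin_left, Rmax_right in HM by lra.
  (* The added 1 keeps [B] positive, so that [eps / B] can serve as a radius. *)
  set (B := Rabs M + 1).
  assert (HB : 0 < B) by (unfold B; generalize (Rabs_pos M); lra).
  apply filterlimi_locally; intro eps.
  assert (Hd : 0 < Rmin (b - a) (eps / B)).
  { apply Rmin_glb_lt; [lra | apply Rdiv_lt_0_compat; [apply cond_pos | exact HB]]. }
  apply Filter_prod with (fun x => a < x < a + Rmin (b - a) (eps / B)) (fun y => y = b).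
  - exists (mkposreal _ Hd); intros y Hy Hy'.
    change (Rabs (y - a) < Rmin (b - a) (eps / B)) in Hy.
    rewrite Rabs_pos_eq in Hy; lra.
  - reflexivity.
  - intros x y Hx ->; simpl.
    assert (Hxb : x < b) by (generalize (Rmin_l (b - a) (eps / B)); lra).
    assert (Hxe : x - a < eps / B) by (generalize (Rmin_r (b - a) (eps / B)); lra).
    assert (E1 : ex_RInt f a x)
      by (apply (ex_RInt_Chasles_1 (V := R_CompleteNormedModule)) with b; [lra | exact Hex]).
    assert (E2 : ex_RInt f x b)
      by (apply (ex_RInt_Chasles_2 (V := R_CompleteNormedModule)) with a; [lra | exact Hex]).
    exists (RInt f x b); split; [now apply (RInt_correct (V := R_CompleteNormedModule))|].
    assert (Hl := RInt_Chasles (V := R_CompleteNormedModule) f a x b E1 E2).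
    rewrite (is_RInt_unique _ _ _ _ H) in Hl; change (RInt f a x + RInt f x b = l) in Hl.
    change (Rabs (RInt f x b - l) < eps).
    replace (RInt f x b - l) with (- RInt f a x) by lra.
    rewrite Rabs_Ropp.
    apply Rle_lt_trans with ((x - a) * B).
    + apply abs_RInt_le_const; [lra | exact E1 |].
      intros t Ht; specialize (HM t ltac:(lra)).
      change (Rabs (f t) <= M) in HM.
      unfold B; generalize (Rle_abs M); lra.
    + apply Rlt_le_trans with (eps / B * B); [now apply Rmult_lt_compat_r|].
      right; field; lra.
Qed.

Lemma J_INR (i : nat) :
  J (RtoC (INR (S i))) = RtoC (2 / PI * (sin_moment (S i) / INR (fact (S i)))).
Proof.
  assert (Hpi := PI_RGT_0).
  assert (E : CRInt_gen (fun x => cpower x (RtoC (INR (S i))) / RtoC (sin x))%C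
                (at_right 0) (at_point (PI / 2)) = RtoC (sin_moment (S i))).
  { unfold CRInt_gen.
    apply (is_RInt_gen_unique (V := C_R_CompleteNormedModule)).
    apply (is_RInt_gen_ext (V := C_R_NormedModule)) with (fun x => RtoC (x ^ S i / sin x)).
    - apply Filter_prod with (fun a => 0 < a < PI / 2) (fun b => b = PI / 2).
      + exists (mkposreal (PI / 2) ltac:(lra)); intros y Hy Hy'.
        change (Rabs (y - 0) < PI / 2) in Hy; rewrite Rminus_0_r, Rabs_pos_eq in Hy; lra.
      + reflexivity.
      + intros a b Ha -> x Hx; simpl in Hx.
        rewrite Rmin_left, Rmax_right in Hx by lra.
        assert (Hs : 0 < sin x) by (apply sin_gt_0; lra).
        rewrite cpower_RtoC, Rpower_pow by lra; apply RtoC_div; lra.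
    - apply is_RInt_gen_RtoC; [apply at_right_proper_filter | apply at_point_filter |].
      apply is_RInt_gen_at_right; [lra | apply is_RInt_sin_moment]. }
  unfold J; rewrite E, Gamma_INR.
  assert (H := INR_fact_neq_0 (S i)).
  unfold Cdiv; rewrite <- RtoC_inv, <- !RtoC_mult by exact H.
  f_equal; unfold Rdiv; ring.
Qed.

(** * The identity for [beta] and [J] *)

Local Open Scope C_scope.

Theorem theorem2 (m : nat) (hm : (1 <= m)%nat) :
  beta (RtoC (INR (2 * m))) =
  sum_n_m (G := C_AbelianMonoid)
    (fun k : nat =>
       RtoC ((-1) ^ (k - 1)) * beta (RtoC (INR (2 * m - 2 * k + 1)))
         * J (RtoC (INR (2 * k - 1))))
    1 m.
Proof.
  destruct m as [|p]; [lia|].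
  rewrite <- sum_n_m_S.
  change (beta (RtoC (INR (2 * S p))) = sum_n (G := C_AbelianMonoid)
    (fun k : nat =>
       RtoC ((-1) ^ (S k - 1)) * beta (RtoC (INR (2 * S p - 2 * S k + 1)))
         * J (RtoC (INR (2 * S k - 1))))%C p).
  (* With [m = p + 1] and [k = i + 1] every summand is real. The factor [2 / PI] from [J] is placed
     last so that it leaves the sum and cancels the [PI / 2] of [beta_nat_even]. *)
  rewrite (sum_n_ext_loc _ (fun i => RtoC ((-1) ^ i * beta_nat (2 * (p - i) + 1)
             * (sin_moment (2 * i + 1) / INR (fact (2 * i + 1))) * (2 / PI)))).
  - rewrite sum_n_RtoC, sum_n_Rmult_r, <- beta_nat_even, beta_INR by lia.
    replace (2 * S p)%nat with (2 * p + 2)%nat by lia.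
    f_equal; field; apply PI_neq0.
  - intros i Hi.
    replace (S i - 1)%nat with i by lia.
    replace (2 * S p - 2 * S i + 1)%nat with (2 * (p - i) + 1)%nat by lia.
    replace (2 * S i - 1)%nat with (S (2 * i)) by lia.
    rewrite J_INR, beta_INR, (Nat.add_1_r (2 * i)), <- !RtoC_mult by lia.
    f_equal; ring.
Qed.
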